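(* For every $c\in[0,1]$, $\mathcal{M}_{K_{1,2}}(c)$ is asymptotically attained on the quasi-star or the quasi-clique. That is, for every $c\in[0,1]$, at least one of the following holds: $$\mathcal{M}_{K_{1,2}}(c) = \limsup_{G\in\mathcal{C}_c\cap\mathcal{Q}} t(K_{1,2},G)\quad\text{or}\quad \mathcal{M}_{K_{1,2}}(c) = \limsup_{G\in\mathcal{C}_c\cap\mathcal{S}} t(K_{1,2},G),$$ where $\mathcal{Q}$ is the set of quasi-cliques and $\mathcal{S}$ is the set of quasi-stars.
   Context: Graphs are finite and simple; $|G|$ is the number of vertices of $G$. $\hom(H,G)$ is the number of homomorphisms (edge-preserving vertex maps) from $H$ to $G$ and $t(H,G)=\hom(H,G)/|G|^{|H|}$. $\mathcal{C}_c=\{G:t(K_2,G)\le c\}$. For a class $\mathcal{C}$ of graphs, $\limsup_{G\in\mathcal{C}}f(G)=\lim_{n\to\infty}\sup\{f(G):G\in\mathcal{C},|G|\ge n\}$, and $\mathcal{M}_H(c)=\limsup_{G\in\mathcal{C}_c}t(H,G)$. $K_{1,2}$ is the star with two edges. A quasi-clique is a graph consisting of a clique together with isolated vertices (either part may be empty); a quasi-star is the complement of a quasi-clique. *)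

(* Defs.v *)
From HB Require Import structures.
From mathcomp Require Import all_boot all_order all_algebra.
From mathcomp Require Import all_classical all_reals all_analysis.

Set Implicit Arguments.
Unset Strict Implicit.
Unset Printing Implicit Defensive.

Import Order.TTheory GRing.Theory Num.Theory.
Import numFieldNormedType.Exports.

Local Open Scope classical_set_scope.
Local Open Scope ring_scope.

Record sgraph := SGraph {
  vertex :> finType;
  edge : rel vertex;
  edge_sym : symmetric edge;
  edge_irrefl : irreflexive edge
}.

Arguments edge {s} x y : rename.

Lemma complete_edge_sym (T : finType) : symmetric (fun x y : T => x != y).
Proof. by move=> x y; rewrite eq_sym. Qed.

Lemma complete_edge_irrefl (T : finType) : irreflexive (fun x y : T => x != y).
Proof. by move=> x; rewrite eqxx. Qed.

Definition complete_graph (n : nat) : sgraph :=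
  SGraph (@complete_edge_sym 'I_n) (@complete_edge_irrefl 'I_n).

(* The center of the star is [ord0]; the n other vertices are its leaves. *)
Definition star_edge (n : nat) : rel 'I_n.+1 :=
  fun x y => (x == ord0) (+) (y == ord0).

Lemma star_edge_sym (n : nat) : symmetric (@star_edge n).
Proof. by move=> x y; rewrite /star_edge addbC. Qed.

Lemma star_edge_irrefl (n : nat) : irreflexive (@star_edge n).
Proof. by move=> x; rewrite /star_edge addbb. Qed.

Definition star_graph (n : nat) : sgraph :=
  SGraph (@star_edge_sym n) (@star_edge_irrefl n).

Definition K2 : sgraph := complete_graph 2.

Definition K12 : sgraph := star_graph 2.

Definition compl_edge (G : sgraph) : rel G :=
  fun x y => (x != y) && ~~ edge x y.

Lemma compl_edge_sym (G : sgraph) : symmetric (@compl_edge G).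
Proof. by move=> x y; rewrite /compl_edge eq_sym edge_sym. Qed.

Lemma compl_edge_irrefl (G : sgraph) : irreflexive (@compl_edge G).
Proof. by move=> x; rewrite /compl_edge eqxx. Qed.

Definition compl_graph (G : sgraph) : sgraph :=
  SGraph (@compl_edge_sym G) (@compl_edge_irrefl G).

Definition is_hom (H G : sgraph) (f : {ffun H -> G}) : bool :=
  [forall x, forall y, edge x y ==> edge (f x) (f y)].

Definition hom_count (H G : sgraph) : nat :=
  #|[pred f : {ffun H -> G} | is_hom f]|.

(* When G has no vertex and H has one, this is 0 / 0 = 0; such a G never
   matters for [limsup_graph]. *)
Definition hom_density (R : realType) (H G : sgraph) : R :=
  (hom_count H G)%:R / (#|G| ^ #|H|)%:R.

(* A [Prop]-valued predicate: universe constraints of the libraries put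
   [sgraph], which quantifies over [finType], out of reach of [set]. *)
Definition graph_class := sgraph -> Prop.

Definition graph_classI (C D : graph_class) : graph_class :=
  fun G => C G /\ D G.

Definition density_class (R : realType) (c : R) : graph_class :=
  fun G => hom_density R K2 G <= c.

(* Taken in the extended reals, where the sequence of suprema, being
   nonincreasing, always converges. *)
Definition limsup_graph (R : realType) (C : graph_class) (f : sgraph -> R) :
    \bar R :=
  limn (fun n : nat => ereal_sup
    [set y : \bar R | exists G : sgraph, [/\ C G, (n <= #|G|)%N & y = (f G)%:E]]).

Definition max_density (R : realType) (H : sgraph) (c : R) : \bar R :=
  limsup_graph (density_class c) (hom_density R H).

Definition quasi_clique : graph_class :=
  fun G => exists A : {set G},
    {in A &, forall x y : G, x != y -> edge x y} /\
    (forall x : G, x \notin A -> forall y : G, ~~ edge x y).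

Definition quasi_star : graph_class :=
  fun G => quasi_clique (compl_graph G).

(* Main.v *)
(* A vertex set [A] of highest degrees can be chosen so that the number of edges
   outside [A] almost equals the number of non-edges inside [A]; moving the
   former onto the latter gives a split graph, and does not decrease the sum of
   squared degrees by more than [O(n^2)]. In a split graph with clique size [a],
   independent set size [b] and [m] edges in between, de Caen's inequality for
   the bipartite part bounds the sum of squared degrees; when [b <= a] the bound
   is below the value [c^(3/2)] of the quasi-clique, and when [a <= b],
   complementation puts it below the value [2c - 1 + (1 - c)^(3/2)] of the
   quasi-star. *)
Require Import Defs.
From HB Require Import structures.
From mathcomp Require Import all_boot all_order all_algebra.
From mathcomp Require Import all_classical all_reals all_analysis.
From mathcomp Require Import ring lra.

Set Implicit Arguments.
Unset Strict Implicit.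
Unset Printing Implicit Defensive.

Import Order.TTheory GRing.Theory Num.Theory.
Import numFieldNormedType.Exports.

Local Open Scope classical_set_scope.
Local Open Scope ring_scope.

(** * Cauchy-Schwarz and de Caen's inequality for bipartite weights *)

Lemma sum_sqr_sub (R : comPzRingType) (I : finType) (A : {set I}) (F : I -> R) :
  \sum_(x in A) \sum_(y in A) (F x - F y) ^+ 2
    = (#|A|%:R * \sum_(x in A) F x ^+ 2 - (\sum_(x in A) F x) ^+ 2) *+ 2.
Proof.
transitivity (\sum_(x in A) (F x ^+ 2 *+ #|A| - F x * (\sum_(y in A) F y) *+ 2
                             + \sum_(y in A) F y ^+ 2)).
  apply: eq_bigr => x _.
  rewrite -sumr_const mulr_sumr -sumrMnl -sumrB -big_split /=.
  by apply: eq_bigr => y _; ring.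
rewrite big_split /= sumrB sumrMnl sumr_const sumrMnl -mulr_suml -mulr_natl.
ring.
Qed.

Lemma sqr_sum_le (R : realFieldType) (I : finType) (A : {set I}) (F : I -> R) :
  (\sum_(x in A) F x) ^+ 2 <= #|A|%:R * \sum_(x in A) F x ^+ 2.
Proof.
rewrite -subr_ge0 -(pmulrn_lge0 _ (ltn0Sn 1)) -sum_sqr_sub.
by apply: sumr_ge0 => x _; apply: sumr_ge0 => y _; apply: sqr_ge0.
Qed.

(* [#|B| * sum g^2 - m^2] is half the sum of the [(g y - g z)^2], to each of
   which Cauchy-Schwarz applies. *)
Lemma bipartite_sum_sqr_deg (R : realFieldType) (I J : finType)
    (A : {set I}) (B : {set J}) (w : I -> J -> R)
    (h := fun x => \sum_(y in B) w x y) (g := fun y => \sum_(x in A) w x y)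
    (m := \sum_(x in A) h x) :
  (forall x y, w x y ^+ 2 = w x y) ->
  #|B|%:R * \sum_(y in B) g y ^+ 2
    <= m ^+ 2 + #|A|%:R * (#|B|%:R * m - \sum_(x in A) h x ^+ 2).
Proof.
move=> w2.
have mE : m = \sum_(y in B) g y by rewrite /m exchange_big.
rewrite -lerBlDl {1}mE -(ler_pMn2r (ltn0Sn 1)) -sum_sqr_sub.
(* As [w] takes only the values 0 and 1, the sum of [(w x y - w x z) ^+ 2] over [y], [z] in [B] is
   twice [#|B| * h x - h x ^+ 2]. *)
have -> : #|A|%:R * (#|B|%:R * m - \sum_(x in A) h x ^+ 2) *+ 2
  = \sum_(y in B) \sum_(z in B) #|A|%:R * \sum_(x in A) (w x y - w x z) ^+ 2.
  rewrite (eq_bigr (fun y => #|A|%:R * \sum_(z in B) \sum_(x in A)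
    (w x y - w x z) ^+ 2)) => [|y _]; last by rewrite mulr_sumr.
  rewrite -mulr_sumr -mulrnAr; congr (_ * _).
  under [in RHS]eq_bigr do rewrite exchange_big.
  rewrite [RHS]exchange_big /= mulr_sumr -sumrB -sumrMnl.
  apply: eq_bigr => x _; rewrite sum_sqr_sub.
  by rewrite (eq_bigr (w x)).
apply: ler_sum => y _; apply: ler_sum => z _.
by rewrite /g -sumrB; apply: sqr_sum_le.
Qed.

(** * Comparison of a graph with a split graph *)

Section SplitGraph.
Variables (R : realFieldType) (T : finType) (w : T -> T -> R).
Hypotheses (wsym : forall x y, w x y = w y x)
  (w01 : forall x y, 0 <= w x y <= 1).
Implicit Type A : {set T}.

(* The diagonal counts as non-edges, which makes complementation exact. *)
Definition split_defect A : R :=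
  \sum_(x in ~: A) \sum_(y in ~: A) w x y
    - \sum_(x in A) \sum_(y in A) (1 - w x y).

(** Sums over all pairs with indicator weights let two defects be compared pair by pair. *)
Lemma split_defectE A : split_defect A = \sum_x \sum_y
  ((x \notin A) && (y \notin A))%:R * w x y
  - \sum_x \sum_y ((x \in A) && (y \in A))%:R * (1 - w x y).
Proof.
congr (_ - _).
  rewrite big_mkcond; apply: eq_bigr => x _; rewrite inE.
  case: ifP => _; last by rewrite big1 // => y _; rewrite mul0r.
  by rewrite big_mkcond; apply: eq_bigr => y _; rewrite inE; case: ifP => _;
     rewrite ?mul1r ?mul0r.
rewrite big_mkcond; apply: eq_bigr => x _.
case: ifP => _; last by rewrite big1 // => y _; rewrite mul0r.
by rewrite big_mkcond; apply: eq_bigr => y _; case: ifP => _;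
  rewrite ?mul1r ?mul0r.
Qed.

(** Only pairs in the row or the column of [u] change their contribution, each by at most 1. *)
Lemma split_defectU1 A u :
  split_defect A <= split_defect (u |: A) + (2 * #|T|)%:R.
Proof.
rewrite !split_defectE -lerBlDl.
have -> : (2 * #|T|)%:R = \sum_(x : T) \sum_(y : T) ((x == u)%:R + (y == u)%:R) :> R.
  under eq_bigr do rewrite big_split /= sumr_const.
  rewrite big_split /= sumrMnl sumr_const.
  have -> : \sum_(x : T) (x == u)%:R = 1 :> R.
    by rewrite (bigD1 u) //= eqxx big1 ?addr0 // => x /negbTE ->.
  by rewrite mul2n -addnn natrD.
rewrite -!sumrB; apply: ler_sum => x _.
rewrite -!sumrB; apply: ler_sum => y _.
have /andP[w0 w1] := w01 x y; rewrite !inE.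
by case: (x == u); case: (y == u); case: (x \in A); case: (y \in A) => /=; lra.
Qed.

Let d x := \sum_y w x y.

(** Take [A] of maximal size among the sets that are closed upwards in degree and have nonnegative
    defect; the empty set is one. The threshold [t] is the highest degree outside [A]. *)
Lemma exists_split : exists A (t : R),
  [/\ forall x, x \in A -> t <= d x, forall x, x \notin A -> d x <= t,
      0 <= t <= #|T|%:R & 0 <= split_defect A <= (2 * #|T|)%:R].
Proof.
have d_ge0 x : 0 <= d x by apply: sumr_ge0 => y _; case/andP: (w01 x y).
have d_le x : d x <= #|T|%:R.
  by rewrite -sumr_const; apply: ler_sum => y _; case/andP: (w01 x y).
pose P A := [forall x in A, forall y in ~: A, d y <= d x] && (0 <= split_defect A).
have P0 : P finset.set0.
  apply/andP; split; first by apply/forallP => x; rewrite inE.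
  rewrite /split_defect big_set0 subr0; apply: sumr_ge0 => x _.
  by apply: sumr_ge0 => y _; case/andP: (w01 x y).
have [A /andP[/forall_inP Aup A0] Amax] :=
  @fintype.arg_maxnP _ _ P (fun A : {set T} => #|A|) P0.
(* If nothing lies outside [A], the defect is at most 0 and the threshold 0 will do. *)
have [AC0|[v vA]] := set_0Vmem (~: A).
  exists A, 0; rewrite A0 lexx ler0n; split=> // [x|].
    by rewrite -finset.in_setC AC0 inE.
  rewrite /split_defect AC0 big_set0 sub0r.
  apply: (@le_trans _ _ 0); last exact: ler0n.
  rewrite oppr_le0.
  apply: sumr_ge0 => x _; apply: sumr_ge0 => y _.
  by rewrite subr_ge0; case/andP: (w01 x y).
have [u uA umax] := Order.TotalTheory.arg_maxP d vA.
exists A, (d u); rewrite d_ge0 d_le A0; split=> // [x xA|x xA|].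
- by have /forall_inP/(_ _ uA) := Aup _ xA.
- by have: x \in ~: A; [rewrite finset.in_setC | apply: umax].
(* With a larger defect, adding [u] would keep the defect nonnegative and the set closed upwards,
   against maximality. *)
rewrite leNgt; apply/negP => big.
have uA' : u \notin A by rewrite -finset.in_setC.
suff: P (u |: A).
  by move/Amax; rewrite cardsU1 uA' add1n /= ltnn.
apply/andP; split; last first.
  by have := split_defectU1 A u; move: big; lra.
apply/forall_inP => x; rewrite 2!inE => xuA.
apply/forall_inP => y; rewrite !inE negb_or => /andP[_ yA].
have yA' : y \in ~: A by rewrite inE.
case/orP: xuA => [/eqP->|/Aup/forall_inP]; last exact.
exact: umax.
Qed.

Lemma split_sum_sqr_deg : (forall x y, w x y ^+ 2 = w x y) ->
  exists a b m Q : R,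
  [/\ [/\ 0 <= a, 0 <= b & a + b = #|T|%:R], 0 <= m <= a * b,
      a ^+ 2 + m *+ 2 <= \sum_x d x,
      \sum_x d x ^+ 2 <= a ^+ 3 + (a * m) *+ 2 + Q + (4 * #|T| ^ 2)%:R &
      (b <= a -> a * Q <= m ^+ 2 + a ^+ 2 * m) /\
      (a <= b -> b * Q <= m ^+ 2 + b ^+ 2 * m)].
Proof.
move=> w2; have [A [t [tA tB /andP[t0 tn] /andP[f0 fn]]]] := exists_split.
pose h x := \sum_(y in ~: A) w x y.
pose g y := \sum_(x in A) w x y.
pose r x := \sum_(y in A) (1 - w x y).
pose s x := \sum_(y in ~: A) w x y.
pose a : R := #|A|%:R; pose b : R := #|~: A|%:R.
pose m := \sum_(x in A) h x.
have mE : m = \sum_(x in ~: A) g x by rewrite /m exchange_big.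
have fE : split_defect A = \sum_(x in ~: A) s x - \sum_(x in A) r x by [].
have sumA F : \sum_x F x = \sum_(x in A) F x + \sum_(x in ~: A) F x :> R.
  by rewrite (bigID (mem A)) /=; congr (_ + _); apply: eq_bigl => x; rewrite inE.
have dA x : d x = a + h x - r x.
  by rewrite /d sumA /r sumrB sumr_const -/a -/(h x); ring.
have dB x : d x = g x + s x.
  by rewrite /d sumA; congr (_ + _); apply: eq_bigr.
have g0 x : 0 <= g x by apply: sumr_ge0 => y _; case/andP: (w01 y x).
have s0 x : 0 <= s x by apply: sumr_ge0 => y _; case/andP: (w01 x y).
have r0 x : 0 <= r x.
  by apply: sumr_ge0 => y _; rewrite subr_ge0; case/andP: (w01 x y).
exists a, b, m, (\sum_(x in A) h x ^+ 2 + \sum_(x in ~: A) g x ^+ 2).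
have m_le : m <= a * b.
  rewrite /m /a -sumr_const mulr_suml; apply: ler_sum => x _.
  rewrite mul1r /b -sumr_const; apply: ler_sum => y _.
  by case/andP: (w01 x y).
have H1 := @bipartite_sum_sqr_deg R T T A (~: A) w w2.
have H2 := @bipartite_sum_sqr_deg R T T (~: A) A (fun x y => w y x)
  (fun x y => w2 y x).
rewrite /= -/m -/a -/b -/h -/g -mE in H1 H2.
split=> //.
- by rewrite !ler0n -natrD cardsC.
- by rewrite m_le andbT; apply: sumr_ge0 => x _; exact: s0.
(* The two sides differ exactly by the defect, which is nonnegative. *)
- rewrite sumA (eq_bigr _ (fun x _ => dA x)) [in leRHS](eq_bigr _ (fun x _ => dB x)).
  rewrite sumrB !big_split /= sumr_const -/m -mE.
  move: f0; rewrite fE -mulr_natr -/a; lra.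
- rewrite sumA.
  have lA : \sum_(x in A) d x ^+ 2
      <= \sum_(x in A) ((a + h x) ^+ 2 - t * r x *+ 2).
    apply: ler_sum => x xA.
    have rx := r0 x; have := ler_wpM2r rx (tA _ xA); have := sqr_ge0 (r x).
    have -> : a + h x = d x + r x by rewrite dA; ring.
    by rewrite sqrrD; lra.
  have lB : \sum_(x in ~: A) d x ^+ 2
      <= \sum_(x in ~: A) (g x ^+ 2 + t * s x *+ 2).
    apply: ler_sum => x; rewrite finset.in_setC => xA.
    have := ler_wpM2r (s0 x) (tB _ xA); have := mulr_ge0 (s0 x) (s0 x).
    by rewrite dB sqrrD; lra.
  apply: le_trans (lerD lA lB) _.
  have f2 : t * split_defect A <= #|T|%:R * (2 * #|T|)%:R by apply: ler_pM.
  have -> : \sum_(x in A) ((a + h x) ^+ 2 - t * r x *+ 2)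
     = a ^+ 3 + a * m *+ 2 + \sum_(x in A) h x ^+ 2 - t * (\sum_(x in A) r x) *+ 2.
    rewrite sumrB sumrMnl -mulr_sumr; congr (_ - _).
    under eq_bigr do rewrite sqrrD.
    rewrite !big_split /= sumr_const -!mulr_sumr -/m -mulr_natr -/a.
    by ring.
  rewrite big_split /= sumrMnl -mulr_sumr.
  move: f2; rewrite fE !natrM; lra.
(* Raising the factor [p] to the larger part size [q] makes the terms in [X] cancel; this serves
   both orders of [a] and [b]. *)
have L (p q : R) X Y : 0 <= p -> 0 <= q -> p <= q ->
    q * Y <= m ^+ 2 + p * (q * m - X) -> 0 <= q * m - X ->
    q * (X + Y) <= m ^+ 2 + q ^+ 2 * m.
  move=> p0 q0 pq H HX; have := ler_wpM2r HX pq; lra.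
have X1 : 0 <= b * m - \sum_(x in A) h x ^+ 2.
  rewrite /m mulr_sumr -sumrB; apply: sumr_ge0 => x _.
  rewrite -mulrBl mulr_ge0 // ?s0 // subr_ge0 /b -sumr_const.
  by apply: ler_sum => y _; case/andP: (w01 x y).
have X2 : 0 <= a * m - \sum_(x in ~: A) g x ^+ 2.
  rewrite mE mulr_sumr -sumrB; apply: sumr_ge0 => x _.
  rewrite -mulrBl mulr_ge0 // ?g0 // subr_ge0 /a -sumr_const.
  by apply: ler_sum => y _; case/andP: (w01 y x).
split=> ab.
  by rewrite addrC; apply: L ab H2 X2; rewrite ler0n.
by apply: L ab H1 X1; rewrite ler0n.
Qed.
End SplitGraph.

(** * Polynomial inequalities for split graphs *)

Lemma clique_bound (R : realFieldType) (a b m Q s : R) :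
  0 < a -> b <= a -> 0 <= m <= a * b -> a * Q <= m ^+ 2 + a ^+ 2 * m ->
  0 <= s -> s ^+ 2 = a ^+ 2 + m *+ 2 ->
  a ^+ 3 + (a * m) *+ 2 + Q <= s ^+ 3.
Proof.
move=> a0 ba /andP[m0 mab] H s0 sE.
have m2 : m <= a ^+ 2 by apply: le_trans mab _; rewrite expr2 ler_wpM2l // ltW.
rewrite -(ler_pM2l a0).
(* After multiplication by [a], the hypothesis on [a * Q] eliminates [Q]. *)
apply: (@le_trans _ _ (a ^+ 4 + 3%:R * a ^+ 2 * m + m ^+ 2)).
  have -> : a * (a ^+ 3 + (a * m) *+ 2 + Q) = a ^+ 4 + a ^+ 2 * m *+ 2 + a * Q by ring.
  by move: H; lra.
have a2 : 0 <= a ^+ 2 by exact: sqr_ge0.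
have a20 : 0 <= a ^+ 2 * m by rewrite mulr_ge0.
(* Squaring leaves only even powers of [s], hence a polynomial in [a] and [m]; its sign follows from
   [m <= a ^+ 2]. *)
rewrite -(@ler_pXn2r _ 2) ?nnegrE //; last 2 first.
- have := sqr_ge0 m; have := sqr_ge0 (a ^+ 2); rewrite -exprM; lra.
- by rewrite mulr_ge0 ?exprn_ge0 // ltW.
rewrite [leRHS]exprMn -exprM mulnC exprM sE -subr_ge0.
have -> : a ^+ 2 * (a ^+ 2 + m *+ 2) ^+ 3
    - (a ^+ 4 + 3 * a ^+ 2 * m + m ^+ 2) ^+ 2
  = m ^+ 2 * (a ^+ 2 * (a ^+ 2 - m) + a ^+ 2 * m *+ 2 + m * (a ^+ 2 - m))
   by ring.
by rewrite mulr_ge0 ?sqr_ge0 // !addr_ge0 ?mulrn_wge0 // mulr_ge0 // subr_ge0.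
Qed.

(** With total weight 1, complementation turns a degree [d] into [1 - d]. If the degrees sum to
    [1 - s ^+ 2], the sum of their squares therefore changes by [- 1 + s ^+ 2 *+ 2], which dictates
    the value of [Q] used for the complement. *)
Lemma star_bound (R : realFieldType) (a b m Q s : R) :
  0 < b -> a <= b -> a + b = 1 -> 0 <= m <= a * b ->
  b * Q <= m ^+ 2 + b ^+ 2 * m ->
  0 <= s -> s ^+ 2 = 1 - (a ^+ 2 + m *+ 2) ->
  a ^+ 3 + (a * m) *+ 2 + Q <= 1 - s ^+ 2 *+ 2 + s ^+ 3.
Proof.
move=> b0 ab ab1 /andP[m0 mab] H s0 sE.
have aE : a = 1 - b by rewrite -ab1; ring.
(* The complement exchanges [a] and [b], and replaces [m] by [a * b - m]. *)
have := @clique_bound R b a (a * b - m)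
  (Q + (a ^+ 3 + (a * m) *+ 2) - 1 + s ^+ 2 *+ 2 - b ^+ 3
    - (b * (a * b - m)) *+ 2) s b0 ab.
have s2 : s ^+ 2 = b ^+ 2 + (a * b - m) *+ 2 by rewrite sE aE; ring.
have c1 : 0 <= a * b - m <= b * a by rewrite subr_ge0 mab mulrC lerBlDr lerDl.
have c2 : b * (Q + (a ^+ 3 + (a * m) *+ 2) - 1 + s ^+ 2 *+ 2 - b ^+ 3
    - (b * (a * b - m)) *+ 2) <= (a * b - m) ^+ 2 + b ^+ 2 * (a * b - m).
  (* Once [s ^+ 2] and [a] are eliminated, the two sides differ by the same polynomial as in [H]. *)
  rewrite -subr_ge0 sE; move: H; rewrite -subr_ge0; congr (0 <= _).
  by rewrite aE; ring.
by move=> /(_ c1 c2 s0 s2); lra.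
Qed.

(** * Homomorphism counts through degrees *)

Definition deg (G : sgraph) (x : G) : nat := #|[pred y | edge x y]|.

Lemma deg_sum (R : pzSemiRingType) (G : sgraph) (x : G) :
  (deg x)%:R = \sum_(y : G) (edge x y)%:R :> R.
Proof.
rewrite /deg -sum1_card big_mkcond natr_sum; apply: eq_bigr => y _.
by rewrite inE; case: (edge x y).
Qed.

(** Once the image [x] of the center is fixed, the leaves are sent independently to neighbours of
    [x]; [F] extends such a choice to the whole star. *)
Lemma hom_count_star (n : nat) (G : sgraph) :
  hom_count (star_graph n) G = (\sum_(x : G) deg x ^ n)%N.
Proof.
rewrite /hom_count -sum1_card.
rewrite (partition_big (fun f : {ffun star_graph n -> G} => f ord0) predT) //=.
apply: eq_bigr => x _; rewrite sum1_card /deg -[in RHS](card_ord n) -card_ffun_on.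
pose F (g : {ffun 'I_n -> G}) : {ffun star_graph n -> G} :=
  [ffun i : 'I_n.+1 => oapp g x (unlift ord0 i)].
have F0 g : F g ord0 = x by rewrite ffunE unlift_none.
have FS g i : F g (lift ord0 i) = g i by rewrite ffunE liftK.
have Finj : injective F by move=> g1 g2 E; apply/ffunP => i; rewrite -!FS E.
rewrite -(fintype.card_image Finj); apply: eq_card => f; rewrite [LHS]unfold_in inE.
apply/andP/fintype.imageP => [[/forallP homf /eqP f0]|[g /ffun_onP gx ->]].
  exists [ffun i => f (lift ord0 i)].
    apply/ffun_onP => i; rewrite ffunE inE -f0.
    by have /forallP/(_ (lift ord0 i))/implyP := homf ord0; apply.
  apply/ffunP => i; rewrite ffunE.
  by case: unliftP => [j ->|->] /=; rewrite ?ffunE.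
split; last by rewrite F0.
apply/forallP => i; apply/forallP => j; apply/implyP.
case: (unliftP ord0 i) => [i' ->|->]; case: (unliftP ord0 j) => [j' ->|->] //=;
  rewrite /star_edge ?F0 ?FS ?eqxx // => _; last exact: gx.
by rewrite edge_sym; apply: gx.
Qed.

Lemma hom_count_K2 (G : sgraph) : hom_count K2 G = (\sum_(x : G) deg x)%N.
Proof.
rewrite -[RHS](hom_count_star 1) /hom_count; apply: eq_card => f; rewrite !inE.
apply: eq_forallb => x; apply: eq_forallb => y; congr (_ ==> _).
by case: x y => -[|[|]] // ? [[|[|]]].
Qed.

Lemma hom_density_K2 (R : realType) (G : sgraph) :
  hom_density R K2 G = (\sum_(x : G) (deg x)%:R) / #|G|%:R ^+ 2.
Proof. by rewrite /hom_density hom_count_K2 card_ord natr_sum natrX. Qed.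

Lemma hom_density_K12 (R : realType) (G : sgraph) :
  hom_density R K12 G = (\sum_(x : G) (deg x)%:R ^+ 2) / #|G|%:R ^+ 3.
Proof.
rewrite /hom_density hom_count_star card_ord natr_sum natrX; congr (_ / _).
by apply: eq_bigr => x _; rewrite natrX.
Qed.

(** * The upper bound for all graphs *)

Definition clique_density (R : realType) (c : R) : R := Num.sqrt c ^+ 3.

(** For [c <= 1] this is [2c - 1 + (1 - c)^(3/2)], written in terms of the relative size of the
    clique in the complement. *)
Definition star_density (R : realType) (c : R) : R :=
  1 - Num.sqrt (1 - c) ^+ 2 *+ 2 + Num.sqrt (1 - c) ^+ 3.

Lemma hom_density_K12_le (R : realType) (c : R) (G : sgraph) :
  c <= 1 -> (0 < #|G|)%N -> hom_density R K2 G <= c ->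
  hom_density R K12 G
    <= Num.max (clique_density c) (star_density c) + 4 / #|G|%:R.
Proof.
move=> c1 G0; rewrite hom_density_K2 hom_density_K12.
set n : R := #|G|%:R; have n0 : 0 < n by rewrite ltr0n.
pose w (x y : G) : R := (edge x y)%:R.
have degE x : (deg x)%:R = \sum_y w x y by rewrite deg_sum.
have [x y|x y|x y|a [b [m [Q]]]] := @split_sum_sqr_deg R G w.
- by rewrite /w edge_sym.
- by rewrite /w; case: (edge x y); rewrite /= ?lexx ler01.
- by rewrite /w; case: (edge x y); rewrite /= ?expr1n ?expr0n.
have -> : \sum_x \sum_y w x y = \sum_(x : G) (deg x)%:R :> R.
  by apply: eq_bigr => x _; rewrite degE.
have -> : \sum_x (\sum_y w x y) ^+ 2 = \sum_(x : G) (deg x)%:R ^+ 2 :> R.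
  by apply: eq_bigr => x _; rewrite degE.
set S1 := \sum_x _; set S2 := \sum_x _.
rewrite natrM natrX -/n => -[[a0 b0 abn] /andP[m0 mab] cS S2le [Qa Qb]] S1le.
have ndiv k x y : x <= y -> x / n ^+ k <= y / n ^+ k.
  by move=> xy; rewrite ler_pM2r // invr_gt0 exprn_gt0.
(* Rescaling gives [a' + b' = 1], as [star_bound] needs, and turns the error [4 * n ^+ 2] into
   [4 / n]. *)
pose a' := a / n; pose b' := b / n; pose m' := m / n ^+ 2; pose Q' := Q / n ^+ 3.
have a'0 : 0 <= a' by rewrite divr_ge0 // ltW.
have b'0 : 0 <= b' by rewrite divr_ge0 // ltW.
have ab' : a' + b' = 1 by rewrite -mulrDl abn divff ?gt_eqF.
have m'0 : 0 <= m' by rewrite divr_ge0 // exprn_ge0 // ltW.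
have nn : n != 0 by rewrite gt_eqF.
have m'ab : m' <= a' * b'.
  by have := ndiv 2%N _ _ mab; congr (_ <= _); rewrite /a' /b'; field.
have c'c : a' ^+ 2 + m' *+ 2 <= c.
  apply: le_trans S1le; have := ndiv 2%N _ _ cS; congr (_ <= _).
  by rewrite /a' /m'; field.
have m'H : 0 <= m' <= a' * b' by rewrite m'0.
have c'0 : 0 <= a' ^+ 2 + m' *+ 2 by rewrite addr_ge0 ?sqr_ge0 ?mulrn_wge0.
have c'1 : 0 <= 1 - (a' ^+ 2 + m' *+ 2) by rewrite subr_ge0 (le_trans c'c).
apply: le_trans (ndiv 3%N _ _ S2le) _.
have -> : (a ^+ 3 + (a * m) *+ 2 + Q + 4 * n ^+ 2) / n ^+ 3
   = a' ^+ 3 + (a' * m') *+ 2 + Q' + 4 / n by rewrite /a' /m' /Q'; field.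
rewrite lerD2r le_max.
case: (leP b a) => ba; apply/orP; [left|right].
- have b'a' : b' <= a' by rewrite ler_pM2r ?invr_gt0.
  have a'p : 0 < a' by lra.
  apply: le_trans (clique_bound a'p b'a' m'H _ (sqrtr_ge0 _) (sqr_sqrtr c'0)) _.
    have := ndiv 4%N _ _ (Qa ba); congr (_ <= _); rewrite /a' /m' /Q'; field=> //.
  by rewrite lerXn2r ?nnegrE ?sqrtr_ge0 // ler_wsqrtr.
- have a'b' : a' <= b' by rewrite ler_pM2r ?invr_gt0 // ltW.
  have b'p : 0 < b' by lra.
  apply: le_trans (star_bound b'p a'b' ab' m'H _ (sqrtr_ge0 _) (sqr_sqrtr c'1)) _.
    have := ndiv 4%N _ _ (Qb (ltW ba)); congr (_ <= _); rewrite /b' /m' /Q'; field=> //.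
  (* The edge density of the split graph is only known to be at most [c], so [s <= s']; the
     factorization below shows that [1 - s ^+ 2 *+ 2 + s ^+ 3] decreases on [[0, 1]]. *)
  rewrite /star_density; set s := Num.sqrt (1 - c); set s' := Num.sqrt _.
  have s0 : 0 <= s by exact: sqrtr_ge0.
  have ss : s <= s' by rewrite ler_wsqrtr // lerD2l lerN2.
  have s1 : s' <= 1 by rewrite -sqrtr1 ler_wsqrtr // gerBl.
  rewrite -subr_ge0.
  have -> : 1 - s ^+ 2 *+ 2 + s ^+ 3 - (1 - s' ^+ 2 *+ 2 + s' ^+ 3)
    = (s' - s) * (s' * (1 - s') + s * (1 - s) + s' * (1 - s) + s) by ring.
  by rewrite mulr_ge0 ?subr_ge0 // !addr_ge0 // ?mulr_ge0 //; lra.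
Qed.

(** * Quasi-cliques, quasi-stars and their degrees *)

Lemma clique_on_edge_sym (T : finType) (A : {set T}) :
  symmetric (fun x y => [&& x \in A, y \in A & x != y]).
Proof. by move=> x y; rewrite eq_sym andbCA. Qed.

Lemma clique_on_edge_irrefl (T : finType) (A : {set T}) :
  irreflexive (fun x y => [&& x \in A, y \in A & x != y]).
Proof. by move=> x; rewrite eqxx !andbF. Qed.

Definition clique_on (T : finType) (A : {set T}) : sgraph :=
  SGraph (clique_on_edge_sym A) (clique_on_edge_irrefl A).

Lemma quasi_clique_on (T : finType) (A : {set T}) : quasi_clique (clique_on A).
Proof.
exists A; split=> [x y /= -> -> ->//|x xA y].
by rewrite /= (negbTE xA).
Qed.

Lemma quasi_star_clique_on (T : finType) (A : {set T}) :
  quasi_star (compl_graph (clique_on A)).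
Proof.
exists A; split=> [x y xA yA xy|x xA y] /=; rewrite /compl_edge /= /compl_edge /=.
  by rewrite xA yA xy.
by rewrite (negbTE xA) /= andbT andbN.
Qed.

Lemma deg_clique_on (R : pzRingType) (T : finType) (A : {set T}) (x : T) :
  (@deg (clique_on A) x)%:R = (if x \in A then #|A|%:R - 1 else 0) :> R.
Proof.
case: ifP => xA; last first.
  by rewrite /deg (eq_card0 (A := [pred y | _])) // => y; rewrite !inE /= xA.
rewrite (cardsD1 x A) xA natrD addrC addKr; congr _%:R; apply: eq_card => y.
by rewrite !inE /= xA /= [y == x]eq_sym andbC.
Qed.

Lemma deg_compl (R : pzRingType) (G : sgraph) (x : G) :
  (@deg (compl_graph G) x)%:R = #|G|%:R - 1 - (deg x)%:R :> R.
Proof.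
rewrite !deg_sum; apply/esym.
have one : \sum_(y : G) (x == y)%:R = 1 :> R.
  rewrite (bigD1 x) //= eqxx big1 ?addr0 // => y.
  by rewrite eq_sym => /negbTE ->.
rewrite -[X in _ - X - _]one -sumr_const -!sumrB.
apply: eq_bigr => y _; rewrite /= /compl_edge.
have [<-|] := eqVneq x y; first by rewrite edge_irrefl /= subrr subr0.
by case: (edge x y); rewrite /= ?subr0 ?subrr.
Qed.

(** * Bounding the limit superior from both sides *)

Lemma limsup_graphE (R : realType) (C : graph_class) (f : sgraph -> R) :
  limsup_graph C f = ereal_inf (range (fun n : nat => ereal_sup
    [set y : \bar R | exists G : sgraph, [/\ C G, (n <= #|G|)%N & y = (f G)%:E]])).
Proof.
apply: cvg_lim => //; apply: ereal_nonincreasing_cvgn => p q pq.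
apply: le_ereal_sup => y [G [CG qG ->]].
by exists G; split=> //; exact: leq_trans qG.
Qed.

Lemma limsup_graph_sub (R : realType) (C D : graph_class) (f : sgraph -> R) :
  (forall G, C G -> D G) -> (limsup_graph C f <= limsup_graph D f)%E.
Proof.
move=> CD; rewrite !limsup_graphE; apply: le_ereal_inf_tmp => _ [n _ <-].
apply: le_trans (ereal_inf_lbound _) _; first by exists n.
apply: le_ereal_sup => y [G [CG nG ->]].
by exists G; split=> //; apply: CD.
Qed.

Lemma divr_nat_small (R : realType) (k e : R) : 0 < e ->
  exists n : nat, (0 < n)%N /\ forall N, (n <= N)%N -> k / N%:R <= e.
Proof.
move=> e0; have ke0 : 0 <= `|k| / e by rewrite divr_ge0 // ltW.
exists (Num.bound (`|k| / e)).+1; split=> // N nN.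
have N0 : 0 < N%:R :> R by rewrite ltr0n (leq_trans _ nN).
rewrite ler_pdivrMr //; apply: le_trans (ler_norm _) _.
rewrite mulrC -ler_pdivrMr //; apply: le_trans (ltW (archi_boundP ke0)) _.
by rewrite ler_nat (leq_trans (leqnSn _)).
Qed.

Lemma limsup_graph_le (R : realType) (C : graph_class) (f : sgraph -> R)
    (v k : R) :
  (forall G, C G -> (0 < #|G|)%N -> f G <= v + k / #|G|%:R) ->
  (limsup_graph C f <= v%:E)%E.
Proof.
move=> fv; rewrite limsup_graphE; apply/lee_addgt0Pr => e e0.
have [n [n0 small]] := divr_nat_small k e0.
apply: le_trans (ereal_inf_lbound _) _; first by exists n.
apply: ge_ereal_sup => _ [G [CG nG ->]].
rewrite -EFinD lee_fin; apply: le_trans (fv _ CG (leq_trans n0 nG)) _.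
by rewrite lerD2l small.
Qed.

Lemma limsup_graph_ge (R : realType) (C : graph_class) (f : sgraph -> R)
    (v k : R) :
  (forall n : nat, (0 < n)%N ->
    exists G, [/\ C G, #|G| = n & v - k / n%:R <= f G]) ->
  (v%:E <= limsup_graph C f)%E.
Proof.
move=> fv; rewrite limsup_graphE; apply: le_ereal_inf_tmp => _ [p _ <-].
apply/lee_addgt0Pr => e e0; have [n [n0 small]] := divr_nat_small k e0.
(* The order [maxn n p] makes the error at most [e] and lets the graph count in the [p]-th
   supremum. *)
have [|G [CG Gn fG]] := fv (maxn n p); first by rewrite leq_max n0.
apply: (@le_trans _ _ ((f G)%:E + e%:E)%E).
  rewrite -EFinD lee_fin; have := small _ (leq_maxl n p); move: fG; lra.
rewrite leeD2r //; apply: ereal_sup_ubound; exists G; split=> //.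
by rewrite Gn leq_maxr.
Qed.

(** * Constructions attaining the two values *)

Lemma exists_set_card (n k : nat) : (k <= n)%N ->
  exists A : {set 'I_n}, #|A| = k.
Proof.
move=> kn; exists (finset (fun i : 'I_n => i < k)%N).
by rewrite cardsE -sum1_card (big_ord_narrow kn) sum1_card card_ord.
Qed.

Lemma sum_deg_clique_on (R : pzRingType) (T : finType) (A : {set T}) p :
  \sum_(x : T) (@deg (clique_on A) x)%:R ^+ p.+1
    = #|A|%:R * (#|A|%:R - 1) ^+ p.+1 :> R.
Proof.
rewrite mulr_natl -sumr_const [RHS]big_mkcond; apply: eq_bigr => x _.
by rewrite deg_clique_on; case: ifP => //; rewrite expr0n.
Qed.

(** A clique on [k], the integer part of [s * n], stays within edge density [c] because of the
    rounding down. The constant 10 is generous: [(k + 1)^3 - k (k - 1)^2 = 5 k^2 + 2 k + 1] is at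
    most [8 n^2]. *)
Lemma limsup_quasi_clique_ge (R : realType) (c : R) : 0 <= c <= 1 ->
  ((clique_density c)%:E
     <= limsup_graph (graph_classI (density_class c) quasi_clique)
          (hom_density R K12))%E.
Proof.
move=> /andP[c0 c1]; apply: (limsup_graph_ge (k := 10)) => n n0.
set s := Num.sqrt c; have s0 : 0 <= s := sqrtr_ge0 _.
have s2 : s ^+ 2 = c by rewrite sqr_sqrtr.
have s1 : s <= 1 by rewrite -sqrtr1 ler_wsqrtr.
have n1 : 1 <= n%:R :> R by rewrite ler1n.
have sn0 : 0 <= s * n%:R by rewrite mulr_ge0.
have sn : s * n%:R <= n%:R by rewrite ler_piMl.
have /andP[kl ku] := truncn_itv sn0.
have kn : (Num.truncn (s * n%:R) <= n)%N by rewrite -(ler_nat R) (le_trans kl).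
have [A Ak] := exists_set_card kn.
have := sum_deg_clique_on R A 0; have := sum_deg_clique_on R A 1.
rewrite Ak; set k : R := (Num.truncn _)%:R => E2 E1.
have k0 : 0 <= k by exact: ler0n.
have {}kn : k <= n%:R by rewrite ler_nat.
rewrite -natr1 -/k in ku; set x := s * n%:R in ku kl sn sn0.
have n3 : 0 < n%:R ^+ 3 :> R by rewrite exprn_gt0 // ltr0n.
have n2 : 0 < n%:R ^+ 2 :> R by rewrite exprn_gt0 // ltr0n.
exists (clique_on A); rewrite card_ord; split=> //.
  split; last exact: quasi_clique_on.
  rewrite /density_class hom_density_K2 card_ord ler_pdivrMr //.
  rewrite (_ : \sum_x _ = k * (k - 1)) //.
  by rewrite -s2 -exprMn -/x; nra.
rewrite hom_density_K12 card_ord E2 /clique_density -/s ler_pdivlMr //.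
rewrite (_ : _ * _ = x ^+ 3 - 10 * n%:R ^+ 2); last first.
  by rewrite /x; field; rewrite pnatr_eq0 -lt0n.
have xk : x ^+ 3 <= (k + 1) ^+ 3.
  by rewrite lerXn2r ?nnegrE ?(ltW ku) // (le_trans sn0) ?ltW.
have kk : k ^+ 2 <= n%:R ^+ 2 by rewrite lerXn2r ?nnegrE.
have : n%:R <= n%:R ^+ 2 :> R by rewrite expr2 ler_peMl.
by move: xk kk; rewrite !exprS expr0; lra.
Qed.

Lemma limsup_quasi_star_ge (R : realType) (c : R) : 0 <= c <= 1 ->
  ((star_density c)%:E
     <= limsup_graph (graph_classI (density_class c) quasi_star)
          (hom_density R K12))%E.
Proof.
move=> /andP[c0 c1]; apply: (limsup_graph_ge (k := 10)) => n n0.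
rewrite /star_density; set s := Num.sqrt _.
have s0 : 0 <= s := sqrtr_ge0 _.
have s2 : s ^+ 2 = 1 - c by rewrite sqr_sqrtr // subr_ge0.
have s1 : s <= 1 by rewrite -sqrtr1 ler_wsqrtr // gerBl.
have n1 : 1 <= n%:R :> R by rewrite ler1n.
have sn0 : 0 <= (1 - s) * n%:R by rewrite mulr_ge0 // subr_ge0.
have sn : (1 - s) * n%:R <= n%:R by rewrite ler_piMl // gerBl.
have /andP[kl ku] := truncn_itv sn0.
have kn : (Num.truncn ((1 - s) * n%:R) <= n)%N by rewrite -(ler_nat R) (le_trans kl).
(* Here the clique in the complement must have at least [s * n] vertices for the edge density to
   stay below [c], so it is [(1 - s) * n] that is rounded down. *)
have [A Ak] := exists_set_card (leq_subr (Num.truncn ((1 - s) * n%:R)) n).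
have := sum_deg_clique_on R A 0; have := sum_deg_clique_on R A 1.
rewrite Ak natrB //; set k : R := _ - _ => E2 E1.
have k0 : 0 <= k by rewrite subr_ge0 (le_trans kl).
have {}kn : k <= n%:R by rewrite gerBl.
rewrite -natr1 in ku; set x := s * n%:R.
have xk : x <= k by rewrite /k /x; move: kl; lra.
have kx : k <= x + 1 by rewrite /k /x; move: ku; lra.
have x0 : 0 <= x by rewrite mulr_ge0.
have n3 : 0 < n%:R ^+ 3 :> R by rewrite exprn_gt0 // ltr0n.
have n2 : 0 < n%:R ^+ 2 :> R by rewrite exprn_gt0 // ltr0n.
exists (compl_graph (clique_on A)); rewrite card_ord; split=> //.
  split; last exact: quasi_star_clique_on.
  rewrite /density_class hom_density_K2 card_ord ler_pdivrMr //.
  under eq_bigr do rewrite deg_compl card_ord.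
  rewrite sumrB sumr_const card_ord (_ : \sum_x _ = k * (k - 1)) //.
  rewrite -[(_ - 1) *+ n]mulr_natr.
  have xx : x ^+ 2 <= k ^+ 2 by rewrite lerXn2r ?nnegrE.
  have : c * n%:R ^+ 2 = n%:R ^+ 2 - x ^+ 2 by rewrite exprMn s2; ring.
  by move=> ->; lra.
rewrite hom_density_K12 card_ord ler_pdivlMr //.
under eq_bigr do rewrite deg_compl card_ord sqrrB.
have {}E1 : \sum_(x : 'I_n) (@deg (clique_on A) x)%:R = k * (k - 1) by exact: E1.
rewrite !big_split /= E2 sumrN sumrMnl sumr_const -mulr_sumr E1.
rewrite card_ord -[_ ^+ 2 *+ n]mulr_natr.
rewrite (_ : _ * n%:R ^+ 3
  = n%:R ^+ 3 - n%:R * x ^+ 2 *+ 2 + x ^+ 3 - 10 * n%:R ^+ 2); last first.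
  by rewrite /x; field; rewrite pnatr_eq0 -lt0n.
(* The size [k] enters with both signs: the cube needs [x <= k], while the negative term
   [n * k ^+ 2] needs [k <= x + 1]. *)
have k3 : x ^+ 3 <= k ^+ 3 by rewrite lerXn2r ?nnegrE.
have k2 : n%:R * k ^+ 2 <= n%:R * (x + 1) ^+ 2.
  by rewrite ler_wpM2l // lerXn2r ?nnegrE // addr_ge0.
have kk : k ^+ 2 <= n%:R ^+ 2 by rewrite lerXn2r ?nnegrE.
have nk : 0 <= n%:R * k by rewrite mulr_ge0.
have nx : n%:R * x <= n%:R * n%:R by rewrite ler_wpM2l // (le_trans xk).
have nn : n%:R <= n%:R * n%:R :> R by rewrite ler_peMl.
by move: k3 k2 kk nk nx nn; rewrite !exprS !expr0; nra.
Qed.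

Theorem theorem1p7 (R : realType) (c : R) (hc : 0 <= c <= 1) :
  max_density K12 c
    = limsup_graph (graph_classI (density_class c) quasi_clique)
        (hom_density R K12)
  \/ max_density K12 c
    = limsup_graph (graph_classI (density_class c) quasi_star)
        (hom_density R K12).
Proof.
have c1 : c <= 1 by case/andP: hc.
have := limsup_quasi_clique_ge hc; have := limsup_quasi_star_ge hc.
have : (max_density K12 c
    <= (Num.max (clique_density c) (star_density c))%:E)%E.
  apply: (limsup_graph_le (k := 4)) => G Gc G0.
  exact: hom_density_K12_le.
(* The larger of the two values decides which family attains the maximum. *)
have [_|_] := leP (clique_density c) (star_density c) => ub lbS lbQ.
  right; apply/le_anti; rewrite (le_trans ub lbS).
  by apply: limsup_graph_sub => G [].
left; apply/le_anti; rewrite (le_trans ub lbQ).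
by apply: limsup_graph_sub => G [].
Qed.
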